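(* Let $n\ge1$. The fundamental interpolation polynomials $\ell_{k,j}$ associated with the Padua points $\mathbf{x}_{k,j}=(\xi_k,\eta_j)\in\mathrm{Pad}_n$ are given by $$\ell_{k,j}(\mathbf{x})=\frac{\mathbf{K}_n^*(\mathbf{x},\mathbf{x}_{k,j})}{\mathbf{K}_n^*(\mathbf{x}_{k,j},\mathbf{x}_{k,j})}=\frac{\mathbf{K}_n(\mathbf{x},\mathbf{x}_{k,j})-T_n(x_1)T_n(\xi_k)}{\mathbf{K}_n(\mathbf{x}_{k,j},\mathbf{x}_{k,j})-[T_n(\xi_k)]^2},\qquad \mathbf{x}=(x_1,x_2)\in\mathbb{R}^2 .$$
   Context: $\Pi_n^2$ is the space of real polynomials in two variables of total degree at most $n$. $T_m$ is the Chebyshev polynomial of the first kind, $T_m(\cos\theta)=\cos m\theta$. Set $\tilde T_0=1$ and $\tilde T_k=\sqrt2\,T_k$ for $k\ge1$, and $P_j^k(x_1,x_2)=\tilde T_{k-j}(x_1)\tilde T_j(x_2)$ for $0\le j\le k$. Define $$\mathbf{K}_n(\mathbf{x},\mathbf{y})=\sum_{k=0}^n\sum_{j=0}^kP_j^k(\mathbf{x})P_j^k(\mathbf{y}),\qquad \mathbf{K}_n^*(\mathbf{x},\mathbf{y})=\mathbf{K}_n(\mathbf{x},\mathbf{y})-T_n(x_1)T_n(y_1).$$ Padua points: for $n\ge1$, $$\mathrm{Pad}_n=\{\mathbf{x}_{k,j}=(\xi_k,\eta_j): 0\le k\le n,\ 1\le j\le \lfloor n/2\rfloor+1+\delta_k\},$$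 where $\xi_k=\cos\frac{k\pi}{n}$; $\eta_j=\cos\frac{(2j-1)\pi}{n+1}$ if $k$ is even and $\eta_j=\cos\frac{(2j-2)\pi}{n+1}$ if $k$ is odd (so $\eta_j$ depends also on the parity of $k$); and $\delta_k=1$ if $n$ and $k$ are both odd, $\delta_k=0$ otherwise. The set $\mathrm{Pad}_n$ is unisolvent for $\Pi_n^2$ (every real function on $\mathrm{Pad}_n$ is interpolated by a unique element of $\Pi_n^2$). The fundamental interpolation polynomials $\ell_{k,j}$ are the polynomials uniquely determined by $\ell_{k,j}\in\Pi_n^2$ and $\ell_{k,j}(\mathbf{x}_{k',j'})=\delta_{k,k'}\delta_{j,j'}$ for all $\mathbf{x}_{k',j'}\in\mathrm{Pad}_n$ (here $\delta_{a,b}$ is the Kronecker delta). *)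

(* Defs.v *)
From mathcomp Require Import all_boot all_order all_algebra.
From mathcomp Require Import mpoly.
From mathcomp Require Import reals.
(* trigo is not imported: the notations it exports clash with those of mpoly. *)
From mathcomp Require trigo.
From mathcomp Require Import ring.

Set Implicit Arguments.
Unset Strict Implicit.
Unset Printing Implicit Defensive.

Import Order.TTheory GRing.Theory Num.Theory.
Local Open Scope ring_scope.

Notation cos := trigo.cos.
Notation pi := (@trigo.pi _).

(* The pair is (T_m, T_(m+1)). *)
Fixpoint cheb_pair (R : nzRingType) (m : nat) : {poly R} * {poly R} :=
  if m is m'.+1 then
    let: (p, q) := cheb_pair R m' in (q, 2%:P * 'X * q - p)
  else (1, 'X).

Definition cheb (R : nzRingType) (m : nat) : {poly R} := (cheb_pair R m).1.

Lemma cheb0 (R : nzRingType) : cheb R 0 = 1.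
Proof. by []. Qed.

Lemma cheb1 (R : nzRingType) : cheb R 1 = 'X.
Proof. by []. Qed.

Lemma chebSS (R : nzRingType) (m : nat) :
  cheb R m.+2 = 2%:P * 'X * cheb R m.+1 - cheb R m.
Proof. by rewrite /cheb /=; case: (cheb_pair R m). Qed.

Lemma cheb_cos (R : realType) (m : nat) (t : R) :
  (cheb R m).[cos t] = cos (m%:R * t).
Proof.
suff [] : (cheb R m).[cos t] = cos (m%:R * t) /\
          (cheb R m.+1).[cos t] = cos (m.+1%:R * t) by [].
elim: m => [|m [IH1 IH2]].
  by rewrite cheb0 cheb1 hornerC hornerX mul0r mul1r trigo.cos0.
split=> //; rewrite chebSS !hornerE IH1 IH2.
have -> : m.+2%:R * t = m.+1%:R * t + t by rewrite -[m.+2]addn1 natrD mulrDl mul1r.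
have -> : m%:R * t = m.+1%:R * t - t by rewrite -[m.+1]addn1 natrD mulrDl mul1r addrK.
by rewrite trigo.cosB (trigo.cosD (_ * t) t); ring.
Qed.

Definition cheb_tilde (R : realType) (m : nat) : {poly R} :=
  if m == 0%N then 1 else Num.sqrt 2 *: cheb R m.

(* A point of R^2 is a function x : 'I_2 -> R, the type at which elements of
   {mpoly R[2]} are evaluated; x_1 is [x 0] and x_2 is [x 1]. *)
Definition Pkj (R : realType) (k j : nat) (x : 'I_2 -> R) : R :=
  (cheb_tilde R (k - j)).[x 0] * (cheb_tilde R j).[x 1].

Definition Kn (R : realType) (n : nat) (x y : 'I_2 -> R) : R :=
  \sum_(0 <= k < n.+1) \sum_(0 <= j < k.+1) Pkj k j x * Pkj k j y.

Definition Kn_star (R : realType) (n : nat) (x y : 'I_2 -> R) : R :=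
  Kn n x y - (cheb R n).[x 0] * (cheb R n).[y 0].

Definition padua_xi (R : realType) (n k : nat) : R := cos (k%:R * pi / n%:R).

Definition padua_eta (R : realType) (n k j : nat) : R :=
  if odd k then cos ((2 * j%:R - 2) * pi / n.+1%:R)
  else cos ((2 * j%:R - 1) * pi / n.+1%:R).

Definition padua_point (R : realType) (n k j : nat) : 'I_2 -> R :=
  fun i => if i == 0 then padua_xi R n k else padua_eta R n k j.

(* The boolean [odd n && odd k] is delta_k, coerced to nat. *)
Definition padua_index (n k j : nat) : bool :=
  (k <= n)%N && (1 <= j <= n./2 + 1 + (odd n && odd k))%N.

(* [msize p] is 1 + the total degree of p, and 0 for p = 0. *)
Definition in_Pi2 (R : realType) (n : nat) (p : {mpoly R[2]}) : Prop :=
  (msize p <= n.+1)%N.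

Definition is_fundamental (R : realType) (n k j : nat) (l : {mpoly R[2]}) : Prop :=
  in_Pi2 n l /\
  forall k' j' : nat, padua_index n k' j' ->
    l.@[padua_point R n k' j'] = ((k == k') && (j == j'))%:R.

(* Main.v *)
Require Import Defs.
From mathcomp Require Import all_boot all_order all_algebra.
From mathcomp Require Import mpoly reals.
From mathcomp Require Import ring zify.
Import Order.TTheory GRing.Theory Num.Theory.
Local Open Scope ring_scope.

(** The Padua points are the points [(cos (k pi / n), cos (m pi / (n+1)))] of
    the full [(n+1) x (n+2)] Chebyshev-Lobatto grid with [k + m] odd: in column
    [k] the index [j] enumerates the rows [m] whose parity is opposite to that of
    [k].

    The theorem is a discrete orthogonality statement followed by a dimension
    count.  Give each node [a] the weight [w_a] equal to the product of the two
    trapezoidal weights, scaled by [2 / (n (n+1))].  The indicator of the nodes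
    on the grid is [(1 - (-1)^k (-1)^m) / 2], so that a sum over the nodes splits
    into two products of one-variable trapezoidal sums.  In the plain product
    these sums give the classical discrete orthogonality of the Chebyshev
    polynomials; in the alternating one, [(-1)^k] is the value of [T_n] at
    [cos (k pi / n)] and [(-1)^m] that of [T_(n+1)] at [cos (m pi / (n+1))], and
    for polynomials of total degree at most [n] one of the two factors vanishes
    by degree.  Hence the [P_j^k] with [k <= n] are orthogonal for the weighted
    sum over the nodes ([Pkj_orthogonal]).  They have norm 1, except [P_0^n],
    whose squared norm is 2 because the trapezoidal rule does not integrate
    [T_n^2] correctly.  The correction [- T_n(x_1) T_n(y_1)] in [K_n^*] is
    exactly what that exception asks for: [K_n^*] is the sum of the
    [P_j^k(x) P_j^k(y)] divided by the discrete squared norms ([Kn_starE]), that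
    is, the reproducing kernel of the discrete inner product.

    There are as many nodes as polynomials [P_j^k]: the half turn of the grid
    exchanges nodes and non-nodes, and likewise the pairs with [j <= k] and the
    others ([card_degree_node]).  The orthogonality relation therefore says that
    a square matrix has a one-sided inverse, which is then two-sided, and the
    relation in the other order reads [K_n^*(x_a, x_b) w_b = (a == b)]
    ([Kn_star_nodes]).  So [w_a K_n^*(., x_a)] is a fundamental polynomial, and
    [w_a] is the inverse of [K_n^*(x_a, x_a)].

    Uniqueness comes from the reproducing property [lagrange_formula], which
    expresses any polynomial of degree at most [n] by its values at the nodes; it
    holds for the [P_j^k] by orthogonality, and these span. *)

(** * Trapezoidal sums of cosines *)

(** The composite trapezoidal rule on [0, ..., N]: the end points count half. *)
Definition trap_weight (R : realType) (N k : nat) : R :=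
  ((0 < k)%N%:R + (k < N)%N%:R) / 2.

Lemma trap_sumE (R : realType) (N : nat) (f : nat -> R) :
  \sum_(k < N.+1) trap_weight R N k * f k =
  (\sum_(k < N) (f k + f k.+1)) / 2.
Proof.
under eq_bigr => k _ do rewrite /trap_weight mulrDl mulrDl.
rewrite !big_split /= mulrDl addrC big_ord_recr big_ord_recl /=.
rewrite ltnn !mul0r addr0 add0r !mulr_suml.
by congr (_ + _); apply: eq_bigr => k _ /=; rewrite ?ltn_ord mul1r mulrC.
Qed.

Lemma sin_natpi (R : realType) (a : nat) : trigo.sin (a%:R * Defs.pi : R) = 0.
Proof.
elim: a => [|a IH]; first by rewrite mul0r trigo.sin0.
by rewrite mulrSr mulrDl mul1r trigo.sinDpi IH oppr0.
Qed.

Lemma cos_natpi (R : realType) (a : nat) : cos (a%:R * Defs.pi : R) = (-1) ^+ a.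
Proof.
elim: a => [|a IH]; first by rewrite mul0r trigo.cos0.
by rewrite mulrSr mulrDl mul1r trigo.cosDpi IH exprS mulN1r.
Qed.

(** With [t] half the angle of the cosines, [sin t * (cos x + cos (x + 2 t))] is
    [cos t * (sin (x + 2 t) - sin x)], so that the sum telescopes. *)
Lemma trap_cos_telescope (R : realType) (N : nat) (t : R) :
  trigo.sin t * \sum_(k < N) (cos (k%:R * (t *+ 2)) + cos (k.+1%:R * (t *+ 2)))
  = cos t * trigo.sin (N%:R * (t *+ 2)).
Proof.
elim: N => [|N IH]; first by rewrite big_ord0 mul0r trigo.sin0 !mulr0.
rewrite big_ord_recr /= mulrDr IH.
set u := N%:R * (t *+ 2).
have -> : N.+1%:R * (t *+ 2) = u + t + t.
  by rewrite /u mulrSr mulrDl mul1r mulr2n addrA.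
have -> : cos u = cos (u + t) * cos t + trigo.sin (u + t) * trigo.sin t.
  by rewrite -trigo.cosB addrK.
have -> : trigo.sin u = trigo.sin (u + t) * cos t - cos (u + t) * trigo.sin t.
  by rewrite -trigo.sinB addrK.
rewrite (trigo.cosD (u + t)) (trigo.sinD (u + t)); ring.
Qed.

(** In the telescoped sum [sin (N (2 t))] is [sin (a pi) = 0], while the factor
    [sin t = sin (a pi / (2 N))] is nonzero because [0 < a < 2 N]. *)
Lemma trap_cos0 (R : realType) (N a : nat) : (0 < N)%N -> (0 < a < 2 * N)%N ->
  \sum_(k < N.+1) trap_weight R N k * cos (a%:R * (k%:R * Defs.pi / N%:R)) = 0.
Proof.
move=> N0 /andP[a0 aN].
have N0R : (N%:R : R) != 0 by rewrite pnatr_eq0 -lt0n.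
rewrite (@trap_sumE R N (fun k => cos (a%:R * (k%:R * Defs.pi / N%:R)))).
pose t : R := a%:R * Defs.pi / (2 * N)%:R.
have tE k : a%:R * (k%:R * Defs.pi / N%:R) = k%:R * (t *+ 2).
  by rewrite /t natrM; field.
under eq_bigr => k _ do rewrite !tE.
have st : trigo.sin t != 0.
  rewrite gt_eqF // trigo.sin_gt0_pi // /t.
  have p0 := trigo.pi_gt0 R.
  have N2 : (0 : R) < (2 * N)%:R by rewrite ltr0n; lia.
  apply/andP; split; first by rewrite divr_gt0 // mulr_gt0 ?ltr0n.
  by rewrite ltr_pdivrMr // mulrC ltr_pM2l // ltr_nat.
apply/eqP; rewrite mulf_eq0 invr_eq0 pnatr_eq0 orbF -(mulrI_eq0 _ (mulfI st)).
rewrite trap_cos_telescope.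
have -> : N%:R * (t *+ 2) = a%:R * Defs.pi by rewrite /t natrM; field.
by rewrite sin_natpi mulr0.
Qed.

Lemma trap_const (R : realType) (N : nat) (c : R) :
  \sum_(k < N.+1) trap_weight R N k * c = N%:R * c.
Proof.
rewrite (@trap_sumE R N (fun _ => c)) sumr_const card_ord -mulr_natl.
by field.
Qed.

(** * Discrete orthogonality of the Chebyshev polynomials *)

Lemma cos_mul_cos (R : realType) (a b : nat) (t : R) : (b <= a)%N ->
  cos (a%:R * t) * cos (b%:R * t) =
  (cos ((a + b)%:R * t) + cos ((a - b)%:R * t)) / 2.
Proof.
move=> ba; rewrite natrD natrB // mulrBl (mulrDl a%:R).
rewrite trigo.cosB trigo.cosD.
by field.
Qed.

Lemma trap_cheb_mul (R : realType) (N i i' : nat) : (i' <= i)%N ->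
  \sum_(k < N.+1) trap_weight R N k *
    ((cheb R i).[padua_xi R N k] * (cheb R i').[padua_xi R N k]) =
  (\sum_(k < N.+1) trap_weight R N k *
     cos ((i + i')%:R * (k%:R * Defs.pi / N%:R)) +
   \sum_(k < N.+1) trap_weight R N k *
     cos ((i - i')%:R * (k%:R * Defs.pi / N%:R))) / 2.
Proof.
move=> ii'; rewrite -big_split /= mulr_suml; apply: eq_bigr => k _.
by rewrite /padua_xi !cheb_cos cos_mul_cos // -mulrDr mulrA.
Qed.

Lemma trap_cheb_neq (R : realType) (N i i' : nat) :
  (i <= N)%N -> (i' <= N)%N -> i != i' ->
  \sum_(k < N.+1) trap_weight R N k *
    ((cheb R i).[padua_xi R N k] * (cheb R i').[padua_xi R N k]) = 0.
Proof.
wlog ii' : i i' / (i' <= i)%N => [H iN i'N ne|iN i'N ne].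
  case: (leqP i' i) => [/H|/ltnW/H]; first exact.
  rewrite eq_sym => /(_ i'N iN ne) E; rewrite -[RHS]E.
  by apply: eq_bigr => k _; congr (_ * _); rewrite mulrC.
have N0 : (0 < N)%N by lia.
rewrite trap_cheb_mul // !trap_cos0 ?addr0 ?mul0r //; lia.
Qed.

(** At [i = N] the frequency [i + i = 2 N] is aliased to [0] on the grid, which
    doubles the sum compared with the interior degrees. *)
Lemma trap_cheb_sqr (R : realType) (N i : nat) : (0 < N)%N -> (i <= N)%N ->
  \sum_(k < N.+1) trap_weight R N k *
    ((cheb R i).[padua_xi R N k] * (cheb R i).[padua_xi R N k]) =
  if (i == 0%N) || (i == N) then N%:R else N%:R / 2.
Proof.
move=> N0 iN; rewrite trap_cheb_mul // subnn.
have E1 : \sum_(k < N.+1) trap_weight R N k *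
    cos (0%:R * (k%:R * Defs.pi / N%:R)) = N%:R.
  rewrite -[RHS]mulr1 -trap_const; apply: eq_bigr => k _.
  by rewrite mul0r trigo.cos0.
rewrite E1; case: ifP => [/orP[/eqP->|/eqP->]|/norP[/eqP i0 /eqP iN']].
- by rewrite E1; field.
- have -> : \sum_(k < N.+1) trap_weight R N k *
      cos ((N + N)%:R * (k%:R * Defs.pi / N%:R)) = N%:R.
    rewrite -[RHS]mulr1 -trap_const; apply: eq_bigr => k _; congr (_ * _).
    have -> : (N + N)%:R * (k%:R * Defs.pi / N%:R) = (2 * k)%:R * Defs.pi :> R.
      by rewrite natrD natrM; field; rewrite pnatr_eq0 -lt0n.
    by rewrite cos_natpi exprM sqrrN !expr1n.
  by field.
- by rewrite trap_cos0 ?add0r //; lia.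
Qed.

(** On the grid [(-1) ^+ k] is [T_N], so the sum involves the frequencies
    [N + i + i'], [N - i - i'], [N + i - i'] and [N - i + i']; all of them lie
    strictly between [0] and [2 N] when [i + i' < N]. *)
Lemma trap_cheb_alt (R : realType) (N i i' : nat) : (i + i' < N)%N ->
  \sum_(k < N.+1) trap_weight R N k *
    ((-1) ^+ k * ((cheb R i).[padua_xi R N k] * (cheb R i').[padua_xi R N k]))
  = 0.
Proof.
wlog ii' : i i' / (i' <= i)%N => [H lt|lt].
  case: (leqP i' i) => [/H|/ltnW/H]; first exact.
  rewrite addnC => /(_ lt) E; rewrite -[RHS]E.
  by apply: eq_bigr => k _; congr (_ * (_ * _)); rewrite mulrC.
have N0 : (0 < N)%N by lia.
pose S a : R :=
  \sum_(k < N.+1) trap_weight R N k * cos (a%:R * (k%:R * Defs.pi / N%:R)).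
suff -> : \sum_(k < N.+1) trap_weight R N k *
    ((-1) ^+ k * ((cheb R i).[padua_xi R N k] * (cheb R i').[padua_xi R N k]))
  = (S (N + (i + i'))%N + S (N - (i + i'))%N + S (N + (i - i'))%N +
     S (N - (i - i'))%N) / 4.
  by rewrite /S !trap_cos0 ?addr0 ?mul0r //; lia.
rewrite /S -!big_split /= mulr_suml; apply: eq_bigr => k _.
rewrite /padua_xi !cheb_cos cos_mul_cos //.
set t := k%:R * Defs.pi / N%:R.
have -> : (-1) ^+ k = cos (N%:R * t).
  rewrite -cos_natpi; congr cos; rewrite /t; field.
  by rewrite pnatr_eq0 -lt0n.
rewrite [X in _ * X]mulrA mulrDr !cos_mul_cos; [|lia..].
by field.
Qed.

Lemma cheb_tildeE (R : realType) (m : nat) :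
  cheb_tilde R m = (if m == 0%N then 1 else Num.sqrt 2) *: cheb R m.
Proof. by rewrite /cheb_tilde; case: eqP => // ->; rewrite scale1r. Qed.

(** The factor [sqrt 2] makes all the norms equal, except that of the aliased
    degree [N]. *)
Lemma trap_tilde (R : realType) (N i i' : nat) :
  (0 < N)%N -> (i <= N)%N -> (i' <= N)%N ->
  \sum_(k < N.+1) trap_weight R N k *
    ((cheb_tilde R i).[padua_xi R N k] * (cheb_tilde R i').[padua_xi R N k]) =
  if i == i' then (if i == N then 2 * N%:R else N%:R) else 0.
Proof.
move=> N0 iN i'N; rewrite !cheb_tildeE.
set c := if i == 0%N then _ else _; set c' := if i' == 0%N then _ else _.
transitivity (c * c' * \sum_(k < N.+1) trap_weight R N k *
    ((cheb R i).[padua_xi R N k] * (cheb R i').[padua_xi R N k])).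
  by rewrite mulr_sumr; apply: eq_bigr => k _; rewrite !hornerZ; ring.
case: eqP => [e|/eqP ne]; last by rewrite trap_cheb_neq ?mulr0.
rewrite /c' -e trap_cheb_sqr // /c.
case: (i =P 0%N) => [->|_] /=.
  by rewrite eq_sym gtn_eqF // !mul1r.
by rewrite -expr2 sqr_sqrtr ?ler0n //; case: eqP => // _; field.
Qed.

Lemma trap_tilde_alt (R : realType) (N i i' : nat) : (i + i' < N)%N ->
  \sum_(k < N.+1) trap_weight R N k * ((-1) ^+ k *
    ((cheb_tilde R i).[padua_xi R N k] * (cheb_tilde R i').[padua_xi R N k]))
  = 0.
Proof.
move=> lt; rewrite !cheb_tildeE.
set c := if i == 0%N then _ else _; set c' := if i' == 0%N then _ else _.
rewrite -[RHS](mulr0 (c * c')) -[in RHS](trap_cheb_alt R _ _ _ lt) mulr_sumr.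
by apply: eq_bigr => k _; rewrite !hornerZ; ring.
Qed.

(** * Discrete orthogonality at the Padua points *)

Definition grid_point (R : realType) (n k m : nat) : 'I_2 -> R :=
  fun i => if i == 0 then padua_xi R n k else padua_xi R n.+1 m.

Definition grid_weight (R : realType) (n k m : nat) : R :=
  2 / (n%:R * n.+1%:R) * (trap_weight R n k * trap_weight R n.+1 m).

(** The indicator of [odd (k + m)] is [(1 - (-1) ^+ k * (-1) ^+ m) / 2], which
    separates the variables. *)
Lemma odd_sum_split (R : realType) (N M : nat) (f g : nat -> R) :
  \sum_(a : 'I_N * 'I_M | odd (a.1 + a.2)) f a.1 * g a.2 =
  ((\sum_(k < N) f k) * (\sum_(m < M) g m) -
   (\sum_(k < N) (-1) ^+ k * f k) * (\sum_(m < M) (-1) ^+ m * g m)) / 2.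
Proof.
rewrite !big_distrlr /= !pair_bigA /= big_mkcond -sumrB mulr_suml.
apply: eq_bigr => a _.
have -> : (-1) ^+ a.1 * f a.1 * ((-1) ^+ a.2 * g a.2) =
    (-1) ^+ (a.1 + a.2) * (f a.1 * g a.2) by rewrite exprD; ring.
by rewrite -(signr_odd R (a.1 + a.2)); case: odd; rewrite ?expr0 ?expr1; field.
Qed.

(** In the alternating part the two factors have degrees [k - j + (k' - j')] and
    [j + j'], which add up to at most [2 n]: either the first is below [n] or the
    second is below [n + 1], and [trap_tilde_alt] applies.  The row direction
    never reaches its aliased degree [n + 1], the column direction reaches [n]
    only for [P_0^n]; hence the single exceptional norm. *)
Lemma Pkj_orthogonal (R : realType) (n k j k' j' : nat) : (0 < n)%N ->
  (j <= k <= n)%N -> (j' <= k' <= n)%N ->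
  \sum_(a : 'I_n.+1 * 'I_n.+2 | odd (a.1 + a.2)) grid_weight R n a.1 a.2 *
    (Pkj k j (grid_point R n a.1 a.2) * Pkj k' j' (grid_point R n a.1 a.2)) =
  if (k == k') && (j == j') then (if (k == n) && (j == 0%N) then 2 else 1)
  else 0.
Proof.
move=> n0 /andP[jk kn] /andP[jk' kn'].
pose f x : R := trap_weight R n x *
  ((cheb_tilde R (k - j)).[padua_xi R n x] *
   (cheb_tilde R (k' - j')).[padua_xi R n x]).
pose g x : R := trap_weight R n.+1 x *
  ((cheb_tilde R j).[padua_xi R n.+1 x] *
   (cheb_tilde R j').[padua_xi R n.+1 x]).
transitivity (2 / (n%:R * n.+1%:R) *
    \sum_(a : 'I_n.+1 * 'I_n.+2 | odd (a.1 + a.2)) f a.1 * g a.2 : R).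
  rewrite mulr_sumr; apply: eq_bigr => a _.
  by rewrite /grid_weight /Pkj /grid_point /= /f /g; ring.
rewrite odd_sum_split.
have -> : (\sum_(x < n.+1) (-1) ^+ x * f x) *
          (\sum_(x < n.+2) (-1) ^+ x * g x) = 0.
  rewrite /f /g; under eq_bigr => x _ do rewrite mulrCA.
  under [X in _ * X]eq_bigr => x _ do rewrite mulrCA.
  have [lt|ge] := ltnP (k - j + (k' - j')) n.
    by rewrite trap_tilde_alt // mul0r.
  by rewrite [X in _ * X]trap_tilde_alt ?mulr0 //; lia.
rewrite /f /g !trap_tilde //; try lia.
rewrite [X in _ * (if _ then X else _)]ifF; last by lia.
have nR : (n%:R : R) != 0 by rewrite pnatr_eq0 -lt0n.
have nR1 : (1 + n%:R : R) != 0 by rewrite addrC natr1 pnatr_eq0.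
have [ejj|njj] := eqVneq j j'; last by rewrite andbF mulr0 subr0 mul0r mulr0.
have -> : (k - j == k' - j')%N = (k == k') by lia.
have -> : (k - j == n)%N = (k == n) && (j == 0%N) by lia.
rewrite andbT; case: eqP => _; last by rewrite mul0r subr0 mul0r mulr0.
by case: andP => _; field; rewrite nR nR1.
Qed.

(** * From orthogonality in degree to duality at the nodes *)

(** A one-sided inverse of a square matrix is two-sided; here the matrices are
    indexed by two predicates of equal cardinal, enumerated consistently. *)
Lemma biorthogonal_swap (F : comNzRingType) (S T : finType)
    (P : {pred S}) (Q : {pred T}) (u : S -> T -> F) (v : T -> S -> F) :
  #|P| = #|Q| ->
  {in P &, forall i i', \sum_(a in Q) u i a * v a i' = (i == i')%:R} ->
  {in Q &, forall a b, \sum_(i in P) v a i * u i b = (a == b)%:R}.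
Proof.
move=> ePQ uv a b Qa Qb.
pose q (x : 'I_#|P|) : T := enum_val (cast_ord ePQ x).
have sumQ f : \sum_(c in Q) f c = \sum_(x < #|P|) f (q x) :> F.
  rewrite big_enum_val (reindex (cast_ord ePQ)) //.
  by apply: onW_bij; exists (cast_ord (esym ePQ)) => x;
     rewrite ?cast_ordK ?cast_ordKV.
pose A := \matrix_(x < #|P|, y < #|P|) u (enum_val x) (q y).
pose B := \matrix_(y < #|P|, x < #|P|) v (q y) (enum_val x).
have AB : A *m B = 1%:M.
  apply/matrixP => x x'; rewrite !mxE.
  under eq_bigr => y _ do rewrite !mxE.
  rewrite -(sumQ (fun c => u (enum_val x) c * v c (enum_val x'))).
  by rewrite uv ?enum_valP // (inj_eq enum_val_inj).
have rk c (Qc : c \in Q) : exists y, q y = c.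
  exists (cast_ord (esym ePQ) (enum_rank_in Qc c)).
  by rewrite /q cast_ordKV enum_rankK_in.
have [[y <-] [z <-]] := (rk a Qa, rk b Qb).
have /matrixP/(_ y z) := mulmx1C AB; rewrite !mxE.
under eq_bigr => x _ do rewrite !mxE.
move=> BA; rewrite big_enum_val BA.
by rewrite (inj_eq enum_val_inj) (inj_eq (@cast_ord_inj _ _ ePQ)).
Qed.

Lemma card_half (T : finType) (h : T -> T) (A : {pred T}) : involutive h ->
  (forall x, (h x \in A) = (x \notin A)) -> (#|A| + #|A|)%N = #|T|.
Proof.
move=> hK hA; rewrite -[RHS](cardC A); congr (_ + _)%N.
rewrite -!sum1_card (reindex_inj (inv_inj hK)).
by apply: eq_bigl => x; rewrite hA.
Qed.

Lemma eq_ord_pair (M N : nat) (a b : 'I_M * 'I_N) :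
  (a == b) = (a.1 == b.1 :> nat) && (a.2 == b.2 :> nat).
Proof. by case: a => ? ?; case: b => ? ?; rewrite xpair_eqE. Qed.

Definition is_node (n : nat) : {pred 'I_n.+1 * 'I_n.+2} :=
  [pred a : 'I_n.+1 * 'I_n.+2 | odd (a.1 + a.2)].

(** The pairs [(k, j)] indexing the [P_j^k] with [k <= n], put in the same
    rectangle as the nodes so that one symmetry counts both. *)
Definition is_degree (n : nat) : {pred 'I_n.+1 * 'I_n.+2} :=
  [pred a : 'I_n.+1 * 'I_n.+2 | (a.2 <= a.1)%N].

(** Under the half turn of the rectangle the sum of the coordinates becomes
    [2 n + 1] minus itself, which changes its parity, and the difference
    [k - j] becomes [j - k - 1], which exchanges [j <= k] and [k < j].  Both sets
    are half of the rectangle. *)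
Lemma card_degree_node (n : nat) : #|is_degree n| = #|is_node n|.
Proof.
pose h (a : 'I_n.+1 * 'I_n.+2) := (rev_ord a.1, rev_ord a.2).
have hK : involutive h by case=> x y; rewrite /h /= !rev_ordK.
suff : (#|is_degree n| + #|is_degree n| = #|is_node n| + #|is_node n|)%N by lia.
rewrite !(card_half _ h) // => -[[x xn] [y yn]]; rewrite !inE /=; last by lia.
suff : (n.+1 - x.+1 + (n.+2 - y.+1) + (x + y))%N = n.*2.+1 by lia.
by lia.
Qed.

(** The squared norm of [P_j^k] for the weighted sum over the nodes. *)
Definition Pkj_norm (R : realType) (n k j : nat) : R :=
  if (k == n) && (j == 0%N) then 2 else 1.

Lemma Pkj_norm_neq0 (R : realType) (n k j : nat) : Pkj_norm R n k j != 0.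
Proof. by rewrite /Pkj_norm; case: ifP => _; rewrite ?oner_neq0 ?pnatr_eq0. Qed.

Lemma KnE (R : realType) (n : nat) (x y : 'I_2 -> R) :
  Kn n x y = \sum_(a in is_degree n) Pkj a.1 a.2 x * Pkj a.1 a.2 y.
Proof.
rewrite /Kn big_mkord -(pair_big_dep xpredT
  (fun (k : 'I_n.+1) (j : 'I_n.+2) => (j <= k)%N)
  (fun (k : 'I_n.+1) (j : 'I_n.+2) => Pkj k j x * Pkj k j y)) /=.
apply: eq_bigr => k _; rewrite big_mkord.
rewrite (big_ord_widen n.+2 (fun j => Pkj k j x * Pkj k j y)) //.
by apply: leqW.
Qed.

(** Since [P_0^n] is [sqrt 2 T_n(x_1)], subtracting [T_n(x_1) T_n(y_1)] halves
    its term, as the division by its squared norm does. *)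
Lemma Kn_starE (R : realType) (n : nat) (x y : 'I_2 -> R) : (0 < n)%N ->
  Kn_star n x y = \sum_(a in is_degree n)
    Pkj a.1 a.2 x * Pkj a.1 a.2 y / Pkj_norm R n a.1 a.2.
Proof.
move=> n0; rewrite /Kn_star KnE.
have top : (ord_max, ord0) \in is_degree n by rewrite inE.
rewrite !(bigD1 _ top) /=.
under [in RHS]eq_bigr => a /andP[_ ne].
  rewrite /Pkj_norm ifF ?divr1; first over.
  by apply: contraNF ne; rewrite eq_ord_pair.
rewrite addrAC; congr (_ + _).
rewrite /Pkj_norm !eqxx /Pkj subn0 !cheb_tildeE /= gtn_eqF // !hornerZ.
rewrite !cheb0 !hornerC !mulr1.
set tx := (cheb R n).[x 0]; set ty := (cheb R n).[y 0].
have -> : Num.sqrt 2 * tx * (Num.sqrt 2 * ty) = Num.sqrt 2 ^+ 2 * (tx * ty).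
  by ring.
by rewrite sqr_sqrtr ?ler0n //; field.
Qed.

(** The values of the [P_j^k] at the nodes form a square matrix, so that
    orthogonality of its rows passes to its columns. *)
Lemma Kn_star_nodes (R : realType) (n : nat) : (0 < n)%N ->
  {in is_node n &, forall a b : 'I_n.+1 * 'I_n.+2,
     Kn_star n (grid_point R n a.1 a.2)
     (grid_point R n b.1 b.2) * grid_weight R n b.1 b.2 = (a == b)%:R}.
Proof.
move=> n0 a b Na Nb.
pose D : finType := ('I_n.+1 * 'I_n.+2)%type.
pose P (i a : D) := Pkj i.1 i.2 (grid_point R n a.1 a.2).
(* The weights go with one matrix, the norms with the other, so that their
   product is the identity. *)
rewrite -(biorthogonal_swap R D D (is_degree n) (is_node n)
  (fun i a => P i a * grid_weight R n a.1 a.2)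
  (fun a i => P i a / Pkj_norm R n i.1 i.2)) //; first last.
- move=> i i' Di Di'; rewrite (eq_bigr (fun c : D =>
    grid_weight R n c.1 c.2 * (P i c * P i' c) / Pkj_norm R n i'.1 i'.2));
    last by move=> c _; ring.
  rewrite -mulr_suml Pkj_orthogonal //; first last.
  + by rewrite [(i'.2 <= _)%N]Di' -ltnS ltn_ord.
  + by rewrite [(i.2 <= _)%N]Di -ltnS ltn_ord.
  rewrite -eq_ord_pair; case: eqP => [->|_]; last by rewrite mul0r.
  by rewrite -/(Pkj_norm R n _ _) divff // Pkj_norm_neq0.
- exact: card_degree_node.
rewrite Kn_starE // mulr_suml; apply: eq_bigr => i _; rewrite /P.
by ring.
Qed.

(** * The Chebyshev products as a basis of the polynomials of degree n *)

Definition Pkj_mpoly (R : realType) (k j : nat) : {mpoly R[2]} :=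
  horner_alg 'X_0 (cheb_tilde R (k - j)) * horner_alg 'X_1 (cheb_tilde R j).

Lemma horner_algZ (R : comNzRingType) (d : nat) (i : 'I_d) (c : R)
    (p : {poly R}) :
  horner_alg ('X_i : {mpoly R[d]}) (c *: p) = c *: horner_alg 'X_i p.
Proof. by rewrite linearZ /= mulr_algl. Qed.

Lemma meval_horner_alg (R : comNzRingType) (d : nat) (i : 'I_d) (p : {poly R})
    (x : 'I_d -> R) : (horner_alg 'X_i p : {mpoly R[d]}).@[x] = p.[x i].
Proof.
elim/poly_ind: p => [|p c IH]; first by rewrite rmorph0 meval0 horner0.
rewrite rmorphD rmorphM /= horner_algX horner_algC mevalD mevalM mevalXU IH.
by rewrite mevalZ meval1 mulr1 hornerMXaddC.
Qed.

Lemma meval_Pkj_mpoly (R : realType) (k j : nat) (x : 'I_2 -> R) :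
  (Pkj_mpoly R k j).@[x] = Pkj k j x.
Proof. by rewrite mevalM !meval_horner_alg. Qed.

Lemma in_Pi2_sum (R : realType) (n : nat) (I : Type) (r : seq I) (P : pred I)
    (F : I -> {mpoly R[2]}) :
  (forall i, P i -> in_Pi2 n (F i)) -> in_Pi2 n (\sum_(i <- r | P i) F i).
Proof.
move=> FP; rewrite /in_Pi2; elim/big_rec: _ => [|i p Pi IH].
  by rewrite msize0.
by rewrite (leq_trans (msizeD_le _ _)) // geq_max IH andbT; exact: FP.
Qed.

Lemma in_Pi2Z (R : realType) (n : nat) (c : R) (p : {mpoly R[2]}) :
  in_Pi2 n p -> in_Pi2 n (c *: p).
Proof. exact: leq_trans (msizeZ_le _ _). Qed.

Lemma in_Pi2M (R : realType) (m n : nat) (p q : {mpoly R[2]}) :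
  in_Pi2 m p -> in_Pi2 n q -> in_Pi2 (m + n) (p * q).
Proof.
rewrite /in_Pi2.
have [->|p0] := eqVneq p 0; first by rewrite mul0r msize0.
have [->|q0] := eqVneq q 0; first by rewrite mulr0 msize0.
by rewrite msizeM //; move: (msize p) (msize q) => a b; lia.
Qed.

Lemma in_Pi2_cheb (R : realType) (i : 'I_2) (m : nat) :
  in_Pi2 m (horner_alg ('X_i : {mpoly R[2]}) (cheb R m)).
Proof.
suff [] : in_Pi2 m (horner_alg ('X_i : {mpoly R[2]}) (cheb R m)) /\
          in_Pi2 m.+1 (horner_alg ('X_i : {mpoly R[2]}) (cheb R m.+1)) by [].
elim: m => [|m [IH IH1]].
  by rewrite cheb0 cheb1 rmorph1 horner_algX /in_Pi2 msize1 msizeX mdeg1.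
split=> //; rewrite chebSS rmorphB /= -mulrA mul_polyC.
rewrite horner_algZ rmorphM /= horner_algX /in_Pi2.
rewrite (leq_trans (msizeD_le _ _)) // msizeN geq_max; apply/andP; split.
  apply: (in_Pi2Z R m.+2); apply: (in_Pi2M R 1 m.+1) => //.
  by rewrite /in_Pi2 msizeX mdeg1.
by apply: leq_trans IH _; lia.
Qed.

Lemma in_Pi2_Pkj (R : realType) (n k j : nat) : (j <= k <= n)%N ->
  in_Pi2 n (Pkj_mpoly R k j).
Proof.
move=> /andP[jk kn]; rewrite /Pkj_mpoly !cheb_tildeE !horner_algZ.
have : in_Pi2 (k - j + j) (horner_alg 'X_0 (cheb R (k - j)) *
   horner_alg 'X_1 (cheb R j) : {mpoly R[2]}).
  by apply: in_Pi2M; apply: in_Pi2_cheb.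
rewrite subnK // => H; rewrite -scalerAl -scalerAr; do 2! apply: in_Pi2Z.
by apply: leq_trans H _.
Qed.

(** Spanning is used as an induction principle: a property that is stable under
    linear combinations and holds for the spanning family holds everywhere.  No
    coefficients have to be named. *)
Definition lin_closed (R : realType) (V : lmodType R) (P : V -> Prop) : Prop :=
  P 0 /\ forall (c : R) (u v : V), P u -> P v -> P (c *: u + v).

(** By induction on [n], applied to the property [Q ('X * p)] of [p]: the
    product of ['X] and [T_i] is the half sum of [T_(i+1)] and [T_(i-1)]. *)
Lemma lin_closed_Xn (R : realType) (n : nat) (Q : {poly R} -> Prop) :
  lin_closed R _ Q -> (forall i, (i <= n)%N -> Q (cheb R i)) -> Q 'X^n.
Proof.
elim: n Q => [|n IH] Q [Q0 QL] Qc; first by rewrite expr0 -(cheb0 R); apply: Qc.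
have QZ c u : Q u -> Q (c *: u) by move=> Qu; rewrite -[_ *: _]addr0; apply: QL.
rewrite exprS; apply: (IH (fun p => Q ('X * p))) => [|[|i] iN].
- split=> [|c u v Qu Qv]; first by rewrite mulr0.
  by rewrite mulrDr -scalerAr; apply: QL.
- by rewrite cheb0 mulr1 -(cheb1 R); apply: Qc.
have -> : 'X * cheb R i.+1 = 2^-1 *: (cheb R i.+2 + cheb R i).
  rewrite chebSS subrK -mulrA mul_polyC scalerA mulVf ?scale1r //.
  by rewrite pnatr_eq0.
apply: QZ; rewrite -[cheb R i.+2]scale1r; apply: QL; apply: Qc; lia.
Qed.

(** A monomial of degree at most [n] is reached by two uses of [lin_closed_Xn],
    one in each variable; the total degree of the Chebyshev products that occur
    never exceeds that of the monomial. *)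
Lemma lin_closed_Pi2 (R : realType) (n : nat) (P : {mpoly R[2]} -> Prop) :
  lin_closed R _ P ->
  (forall k j, (j <= k <= n)%N -> P (Pkj_mpoly R k j)) ->
  forall l, in_Pi2 n l -> P l.
Proof.
move=> [P0 PL] Pb l ln.
have PZ c u : P u -> P (c *: u) by move=> Pu; rewrite -[_ *: _]addr0; apply: PL.
have Pc i j : (i + j <= n)%N ->
    P (horner_alg 'X_0 (cheb R i) * horner_alg 'X_1 (cheb R j)).
  move=> ij; have := Pb (i + j)%N j; rewrite leq_addl ij => /(_ isT).
  rewrite /Pkj_mpoly addnK !cheb_tildeE !horner_algZ.
  rewrite -scalerAl -scalerAr scalerA.
  set c := _ * _; set p := _ * _ => Pcp.
  have c0 : c != 0.
    by rewrite mulf_neq0 //; case: ifP => _;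
       rewrite ?oner_neq0 // sqrtr_eq0 -ltNge ltr0n.
  by rewrite -[p]scale1r -(mulVf c0) -scalerA; apply: PZ.
have PX a b : (a + b <= n)%N -> P ('X_0 ^+ a * 'X_1 ^+ b).
  move=> ab; rewrite -(horner_algX ('X_0 : {mpoly R[2]})).
  rewrite -(horner_algX ('X_1 : {mpoly R[2]})) -!rmorphXn /=.
  apply: (lin_closed_Xn R a (fun p => P (horner_alg 'X_0 p * _))).
    split=> [|c u v Pu Pv]; first by rewrite rmorph0 mul0r.
    by rewrite rmorphD /= horner_algZ mulrDl -scalerAl; apply: PL.
  move=> i ia.
  apply: (lin_closed_Xn R b (fun p => P (_ * horner_alg 'X_1 p))).
    split=> [|c u v Pu Pv]; first by rewrite rmorph0 mulr0.
    by rewrite rmorphD /= horner_algZ mulrDr -scalerAr; apply: PL.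
  by move=> j jb; apply: Pc; lia.
rewrite (mpolyE l) big_seq; elim/big_rec: _ => // m q ml Pq.
apply: PL => //; rewrite mpolyXE_id big_ord_recl big_ord1; apply: PX.
have := leq_trans (msize_mdeg_lt ml) ln.
by rewrite ltnS mdegE big_ord_recl big_ord1.
Qed.

(** * The fundamental polynomials *)

Definition Kn_star_mpoly (R : realType) (n : nat) (y : 'I_2 -> R) :
    {mpoly R[2]} :=
  \sum_(a in is_degree n)
    (Pkj a.1 a.2 y / Pkj_norm R n a.1 a.2) *: Pkj_mpoly R a.1 a.2.

Lemma meval_Kn_star_mpoly (R : realType) (n : nat) (x y : 'I_2 -> R) :
  (0 < n)%N -> (Kn_star_mpoly R n y).@[x] = Kn_star n x y.
Proof.
move=> n0; rewrite Kn_starE // raddf_sum; apply: eq_bigr => a _ /=.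
by rewrite mevalZ meval_Pkj_mpoly; ring.
Qed.

Lemma is_degreeP (n : nat) (a : 'I_n.+1 * 'I_n.+2) :
  a \in is_degree n -> (a.2 <= a.1 <= n)%N.
Proof. by move=> Da; rewrite [(a.2 <= _)%N]Da -ltnS ltn_ord. Qed.

Lemma in_Pi2_Kn_star_mpoly (R : realType) (n : nat) (y : 'I_2 -> R) :
  in_Pi2 n (Kn_star_mpoly R n y).
Proof.
apply: in_Pi2_sum => a Da; apply: in_Pi2Z; apply: in_Pi2_Pkj.
exact: is_degreeP.
Qed.

(** Both sides are linear in [l], and for [l = P_j^k] the sum over the nodes
    extracts the [P_j^k] term of the kernel by discrete orthogonality. *)
Lemma lagrange_formula (R : realType) (n : nat) (l : {mpoly R[2]}) :
  (0 < n)%N -> in_Pi2 n l ->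
  l = \sum_(a in is_node n)
        (l.@[grid_point R n a.1 a.2] * grid_weight R n a.1 a.2)
        *: Kn_star_mpoly R n (grid_point R n a.1 a.2).
Proof.
move=> n0; move: l; apply: lin_closed_Pi2.
  split=> [|c u v Eu Ev].
    by rewrite big1 // => a _; rewrite meval0 mul0r scale0r.
  rewrite {1}Eu {1}Ev scaler_sumr -big_split; apply: eq_bigr => a _ /=.
  by rewrite mevalD mevalZ mulrDl scalerDl scalerA mulrA.
move=> k j kj; have /andP [jk kn] := kj.
have kn1 : (k < n.+1)%N by [].
have jn : (j < n.+2)%N by lia.
pose d : 'I_n.+1 * 'I_n.+2 := (Ordinal kn1, Ordinal jn).
have Dd : d \in is_degree n by [].
under eq_bigr => a _ do rewrite meval_Pkj_mpoly /Kn_star_mpoly scaler_sumr.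
rewrite exchange_big /= (bigD1 d) //=.
rewrite [X in _ + X]big1 ?addr0 => [|i /andP[Di ne]].
  under eq_bigr => a _ do rewrite scalerA.
  rewrite -scaler_suml; set c := (X in X *: _).
  suff -> : c = 1 by rewrite scale1r.
  transitivity (Pkj_norm R n k j / Pkj_norm R n k j); last first.
    by rewrite divff // Pkj_norm_neq0.
  have := Pkj_orthogonal R n k j k j n0 kj kj.
  rewrite !eqxx /= -/(Pkj_norm R n k j) => E.
  rewrite -[X in _ = X / _]E.
  by rewrite mulr_suml; apply: eq_bigr => a _; ring.
under eq_bigr => a _ do rewrite scalerA.
rewrite -scaler_suml; set c := (X in X *: _).
suff -> : c = 0 by rewrite scale0r.
have := Pkj_orthogonal R n k j i.1 i.2 n0 kj (is_degreeP n i Di).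
rewrite ifF => [E|]; last first.
  by apply: contraNF ne; rewrite eq_ord_pair eq_sym [j == _]eq_sym.
rewrite -[RHS](mul0r (Pkj_norm R n i.1 i.2)^-1) -E mulr_suml.
by apply: eq_bigr => a _; ring.
Qed.

(** The row of the grid in which the [j]-th Padua point of column [k] lies. *)
Definition padua_row (k j : nat) : nat := ((j.-1).*2 + ~~ odd k)%N.

Lemma padua_pointE (R : realType) (n k j : nat) : padua_index n k j ->
  padua_point R n k j = grid_point R n k (padua_row k j).
Proof.
case/andP=> _ /andP[j0 _]; rewrite /padua_point /grid_point.
suff -> : padua_eta R n k j = padua_xi R n.+1 (padua_row k j) by [].
rewrite /padua_eta /padua_xi /padua_row; case: j j0 => // j _ /=.
by case: odd; congr (cos (_ * _ / _));
   rewrite natrD -muln2 natrM -natr1 /=; ring.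
Qed.

Lemma padua_index_node (n k j : nat) : padua_index n k j ->
  exists2 a : 'I_n.+1 * 'I_n.+2, a \in is_node n &
    k = a.1 /\ padua_row k j = a.2.
Proof.
case/and3P => kn j0 jn.
have kn1 : (k < n.+1)%N by [].
have rn : (padua_row k j < n.+2)%N by rewrite /padua_row; lia.
exists (Ordinal kn1, Ordinal rn) => //; rewrite inE /= /padua_row; lia.
Qed.

Lemma node_padua_index (n : nat) (a : 'I_n.+1 * 'I_n.+2) : a \in is_node n ->
  padua_index n a.1 a.2./2.+1 /\ padua_row a.1 a.2./2.+1 = a.2.
Proof.
case: a => -[k kn] [m mn]; rewrite inE /= /padua_index /padua_row /= => odd_km.
split; lia.
Qed.

Lemma padua_row_inj (k j j' : nat) : (0 < j)%N -> (0 < j')%N ->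
  padua_row k j = padua_row k j' -> j = j'.
Proof. rewrite /padua_row; lia. Qed.

(** A fundamental polynomial is forced by [lagrange_formula], where a single
    term survives; conversely [Kn_star_nodes] gives the required values. *)
Lemma is_fundamental_iff (R : realType) (n k j : nat) (l : {mpoly R[2]}) :
  (0 < n)%N -> padua_index n k j ->
  is_fundamental n k j l <->
  l = grid_weight R n k (padua_row k j)
        *: Kn_star_mpoly R n (padua_point R n k j).
Proof.
move=> n0 kj; have [a Na [ka ra]] := padua_index_node _ _ _ kj.
rewrite padua_pointE //; split=> [[ln lp]|->].
  rewrite {1}(lagrange_formula R n l n0 ln) (bigD1 a) //=.
  rewrite -ka -ra -padua_pointE // lp // !eqxx mul1r.
  rewrite big1 ?addr0 // => b /andP[Nb ne].
  have [bi br] := node_padua_index _ _ Nb.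
  have := lp _ _ bi; rewrite padua_pointE // br => ->.
  suff /negbTE -> : ~~ ((k == b.1) && (j == b.2./2.+1)).
    by rewrite mul0r scale0r.
  apply: contra ne => /andP[/eqP e1 /eqP e2].
  by rewrite eq_ord_pair -ka -ra -br -e1 -e2 !eqxx.
split=> [|k' j' kj']; first by apply: in_Pi2Z; apply: in_Pi2_Kn_star_mpoly.
have [b Nb [kb rb]] := padua_index_node _ _ _ kj'.
rewrite padua_pointE // mevalZ meval_Kn_star_mpoly // ra ka rb kb mulrC.
rewrite Kn_star_nodes //; congr (_%:R); congr nat_of_bool.
rewrite eq_ord_pair -ka -ra -kb -rb eq_sym; case: eqP => //= <-; rewrite eq_sym.
have [[_ /andP[j0 _]] [_ /andP[j0' _]]] := (andP kj, andP kj').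
by apply/eqP/eqP => [|->//]; apply: padua_row_inj.
Qed.

Theorem theorem3p2 (R : realType) (n : nat) (hn : (1 <= n)%N)
    (k j : nat) (hkj : padua_index n k j) :
  (exists! l : {mpoly R[2]}, is_fundamental n k j l) /\
  Kn_star n (padua_point R n k j) (padua_point R n k j) <> 0 /\
  forall l : {mpoly R[2]}, is_fundamental n k j l ->
    forall x : 'I_2 -> R,
      l.@[x] = Kn_star n x (padua_point R n k j)
               / Kn_star n (padua_point R n k j) (padua_point R n k j) /\
      Kn_star n x (padua_point R n k j)
        / Kn_star n (padua_point R n k j) (padua_point R n k j)
      = (Kn n x (padua_point R n k j)
           - (cheb R n).[x 0] * (cheb R n).[padua_xi R n k])
        / (Kn n (padua_point R n k j) (padua_point R n k j)
             - (cheb R n).[padua_xi R n k] ^+ 2).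
Proof.
pose w := grid_weight R n k (padua_row k j).
have fund l := is_fundamental_iff R n k j l hn hkj.
have wK : w * Kn_star n (padua_point R n k j) (padua_point R n k j) = 1.
  have [_ /(_ k j hkj)] := (fund _).2 erefl.
  by rewrite mevalZ meval_Kn_star_mpoly // !eqxx.
have K0 : Kn_star n (padua_point R n k j) (padua_point R n k j) != 0.
  by apply: contra_eq_neq wK => ->; rewrite mulr0 eq_sym oner_neq0.
split; last split; first last.
- move=> l /fund -> x; split; last by rewrite /Kn_star expr2.
  by rewrite mevalZ meval_Kn_star_mpoly // -/w -[w](mulfK K0) wK mul1r mulrC.
- exact/eqP.
eexists; split; first by apply/fund.
by move=> l /fund.
Qed.
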